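(* Let $r\ge 1$ and let $n_1,\ldots,n_r$ be any finite sequence of integers. Then there exist $l\in\mathbb{N}$ and a divisor $f(x)=\sum_{i=0}^{\deg(f)}a_ix^i\in\mathbb{Z}[x]$ of $x^{l}-1$ such that $a_i=n_i$ for all $1\leq i\leq r$.
   Context: Divisors of $x^l-1$ are taken in $\mathbb{Z}[x]$; $\mathbb{N}$ denotes the positive integers; $a_i$ is the coefficient of $x^i$ in $f$. *)

(* Defs.v *)
From mathcomp Require Export all_boot all_order all_algebra.

(* Divisibility in {poly int} itself. The library's (p %| q) is
   pseudo-divisibility on {poly int}, i.e. divisibility over the rationals:
   for instance (2%:P %| 1) holds there. *)
Definition divides_Zx (f p : {poly int}) : Prop :=
  exists g : {poly int}, p = (g * f)%R.

(* Main.v *)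
(** Corrections are made one coefficient at a time.  If [f] divides [X^l - 1]
    and [f(0) = 1], put [p = 3 l - 1], [q = p + 1] and
    [P = 1 + X + ... + X^(p-1)].  Since [q = 1 mod p], [P] divides [P(X^q)],
    say [P(X^q) = H P]; moreover [P = 1 + X + ...] and [H = 1 - X + ...].
    As [f] divides [X^q - 1], for [k >= 1] the products [f P(X^k)] and
    [f H(X^k)] divide [(X^(qk) - 1) P(X^(qk)) = X^(qkp) - 1]; they agree with
    [f] below degree [k], and their [k]-th coefficient is that of [f] changed
    by [+1] and [-1] respectively. *)
Require Import Defs.
From mathcomp Require Import all_boot all_order all_algebra.
From mathcomp Require Import ring zify.
Import GRing.Theory.
Local Open Scope ring_scope.

(** Termwise, [x^((p+1)i) - x^i = x^i ((x^p)^i - 1)], a multiple of [x^p - 1] and hence of the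
    geometric sum; adding these multiples up gives [h]. *)
Lemma geometric_sum_dvd (R : comNzRingType) (x : R) (p : nat) :
  exists h : R, \sum_(i < p) (x ^+ p.+1) ^+ i = h * \sum_(i < p) x ^+ i.
Proof.
exists (1 + \sum_(i < p) x ^+ i * ((x - 1) * \sum_(j < i) (x ^+ p) ^+ j)).
rewrite mulrDl mul1r mulr_suml -big_split /=; apply: eq_bigr => i _.
have eq_i := subrX1 (x ^+ p) i; rewrite (subrX1 x p) in eq_i.
rewrite exprS exprMn -[(x ^+ p) ^+ i](subrK 1) eq_i.
ring.
Qed.

Lemma divides_Zx_subX1 (a b : nat) :
  (a %| b)%N -> divides_Zx ('X^a - 1) ('X^b - 1).
Proof.
case/dvdnP=> c ->; exists (\sum_(i < c) 'X^a ^+ i).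
by rewrite mulrC -subrX1 -exprM mulnC.
Qed.

Lemma divides_Zx_comp (f g h : {poly int}) :
  divides_Zx f g -> divides_Zx (f \Po h) (g \Po h).
Proof. by case=> u ->; exists (u \Po h); rewrite comp_polyM. Qed.

Lemma divides_Zx_trans (f g h : {poly int}) :
  divides_Zx f g -> divides_Zx g h -> divides_Zx f h.
Proof. by case=> u -> [v ->]; exists (v * u); rewrite mulrA. Qed.

Lemma divides_Zx_mul (f g f' g' : {poly int}) :
  divides_Zx f f' -> divides_Zx g g' -> divides_Zx (f * g) (f' * g').
Proof. by case=> u -> [v ->]; exists (u * v); rewrite mulrACA. Qed.

Lemma coef1M (R : nzRingType) (f g : {poly R}) :
  (f * g)`_1 = f`_0 * g`_1 + f`_1 * g`_0.
Proof. by rewrite coefM !big_ord_recl big_ord0 addr0. Qed.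

Lemma coef_geometric_sum (R : nzRingType) (p j : nat) :
  (\sum_(i < p) 'X^i : {poly R})`_j = (j < p)%:R.
Proof.
have -> : \sum_(i < p) 'X^i = \poly_(i < p) (1 : R).
  by rewrite poly_def; apply: eq_bigr => i _; rewrite scale1r.
by rewrite coef_poly; case: ltnP.
Qed.

(** Modulo [X^(k+1)], [g(X^k)] is [1 + g_1 X^k], and [f_0 = 1] makes the change in degree [k]
    exactly [g_1]. *)
Lemma coef_mul_comp_Xn (R : comNzRingType) (f g : {poly R}) (k i : nat) :
  (0 < k)%N -> f`_0 = 1 -> g`_0 = 1 -> (i <= k)%N ->
  (f * (g \Po 'X^k))`_i = f`_i + (i == k)%:R * g`_1.
Proof.
move=> k_gt0 f0 g0 le_ik; rewrite coefMr big_ord_recl /=.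
rewrite coef_comp_poly_Xn // dvdn0 div0n g0 mulr1 subn0; congr (_ + _).
case: eqVneq le_ik => [-> _ | ne_ik le_ik].
  case: k k_gt0 => // k _.
  rewrite big_ord_recr /= big1 => [|j _].
    by rewrite coef_comp_poly_Xn // /bump /= dvdnn divnn subnn f0 add0r.
  rewrite coef_comp_poly_Xn // /bump /= gtnNdvd ?mulr0 //.
  by rewrite add1n ltnS ltn_ord.
rewrite mul0r big1 // => j _.
rewrite coef_comp_poly_Xn // /bump /= gtnNdvd ?mulr0 //.
by have := ltn_ord j; lia.
Qed.

(** The invariant of the induction; the normalisation of the constant term keeps every correction
    exact. *)
Definition unit_divisor (f : {poly int}) : Prop :=
  f`_0 = 1 /\ exists2 l : nat, (0 < l)%N & divides_Zx f ('X^l - 1).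

(** With [Y = X^(k(p+1))], [f] divides [Y - 1] and [g(X^k)] divides [1 + Y + ... + Y^(p-1)]; the
    product of these two is [Y^p - 1]. *)
Lemma unit_divisor_mul (f g : {poly int}) (p k : nat) :
  (0 < p)%N -> (0 < k)%N -> f`_0 = 1 -> divides_Zx f ('X^(p.+1) - 1) ->
  g`_0 = 1 -> divides_Zx g (\sum_(i < p) 'X^(p.+1) ^+ i) ->
  unit_divisor (f * (g \Po 'X^k)).
Proof.
move=> p_gt0 k_gt0 f0 dvd_f g0 dvd_g; split.
  by rewrite coef_mul_comp_Xn // f0 eq_sym gtn_eqF ?mul0r ?addr0.
exists (k * p.+1 * p)%N; first by rewrite !muln_gt0 k_gt0 p_gt0.
rewrite exprM subrX1; apply: divides_Zx_mul.
  by apply: divides_Zx_trans dvd_f _; apply: divides_Zx_subX1; apply: dvdn_mull.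
have := divides_Zx_comp _ _ 'X^k dvd_g.
rewrite raddf_sum /=; under eq_bigr do
  rewrite !rmorphXn /= comp_polyX -!exprM mulnA exprM.
by [].
Qed.

Lemma unit_divisor_step (f : {poly int}) (k : nat) (b : bool) :
  (0 < k)%N -> unit_divisor f ->
  exists2 f' : {poly int}, unit_divisor f' &
    forall i, (i <= k)%N -> f'`_i = f`_i + (i == k)%:R * (-1) ^+ b.
Proof.
move=> k_gt0 [f0 [l l_gt0 dvd_f]].
(* The factor 3 forces [p >= 2] even when [l = 1], so that [P] has a term in [X]. *)
have [p p_gt1 eq_p] : exists2 p, (1 < p)%N & p.+1 = (l * 3)%N.
  by exists (l * 3).-1; lia.
have {}dvd_f : divides_Zx f ('X^(p.+1) - 1).
  rewrite eq_p; apply: divides_Zx_trans dvd_f _.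
  by apply: divides_Zx_subX1; apply: dvdn_mulr.
have p_gt0 : (0 < p)%N by apply: ltnW.
have [h eq_h] := @geometric_sum_dvd {poly int} 'X p.
set P := \sum_(i < p) 'X^i in eq_h.
have P0 : P`_0 = 1 by rewrite coef_geometric_sum p_gt0.
have P1 : P`_1 = 1 by rewrite coef_geometric_sum p_gt1.
have PX : P \Po 'X^(p.+1) = h * P.
  rewrite raddf_sum /= -eq_h; apply: eq_bigr => i _.
  by rewrite rmorphXn /= comp_polyX.
have h0 : h`_0 = 1.
  have := congr1 (coefp 0) PX; rewrite /= coef0M P0 mulr1 => <-.
  by rewrite coef_comp_poly_Xn // dvdn0 div0n.
(* Compare coefficients of [X] in [P(X^(p+1)) = h P]: the left one is 0 because [p + 1 > 1], the
   right one is [1 + h_1]. *)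
have h1 : h`_1 = -1.
  have := congr1 (coefp 1) PX; rewrite /= coef1M h0 P0 P1 !mulr1.
  rewrite coef_comp_poly_Xn // gtnNdvd //.
  by move/esym/eqP; rewrite addrC addr_eq0 => /eqP.
have [g [g0 g1 dvd_g]] : exists g : {poly int}, [/\ g`_0 = 1,
    g`_1 = (-1) ^+ b & divides_Zx g (\sum_(i < p) 'X^(p.+1) ^+ i)].
  (* Either factor of [h P] divides the sum; [h] lowers the coefficient and [P] raises it. *)
  case: b; [exists h | exists P]; split=> //.
    by exists P; rewrite mulrC.
  by exists h.
exists (f * (g \Po 'X^k)); first exact: unit_divisor_mul p_gt0 _ _ _ _ _.
by move=> i le_ik; rewrite coef_mul_comp_Xn // g1.
Qed.

Lemma unit_divisor_shift (f : {poly int}) (k : nat) (z : int) :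
  (0 < k)%N -> unit_divisor f ->
  exists2 f' : {poly int}, unit_divisor f' &
    forall i, (i <= k)%N -> f'`_i = f`_i + (i == k)%:R * z.
Proof.
(* Unit steps with the sign of [z] are repeated [|z|] times, all in degree [k]. *)
move=> k_gt0 div_f; rewrite [z]intEsign; elim: `|z|%N => [|m [f1 div_f1 coef_f1]].
  by exists f => // i _; rewrite !mulr0 addr0.
have [f2 div_f2 coef_f2] := unit_divisor_step _ _ (z < 0)%R k_gt0 div_f1.
exists f2 => // i le_ik; rewrite coef_f2 // coef_f1 // intS.
ring.
Qed.

(** Induction on [r], starting from [f = 1], which divides [X - 1]: adding the defect in degree
    [r+1] does not disturb the lower degrees already settled. *)
Lemma unit_divisor_prescribed (n : nat -> int) (r : nat) :
  exists2 f : {poly int}, unit_divisor f &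
    forall i : nat, (1 <= i <= r)%N -> f`_i = n i.
Proof.
elim: r => [|r [f div_f coef_f]].
  exists 1; last by case.
  split; first by rewrite coef1.
  by exists 1%N => //; exists ('X^1 - 1); rewrite mulr1.
have [f1 div_f1 coef_f1] :=
  unit_divisor_shift _ _ (n r.+1 - f`_r.+1) (ltn0Sn r) div_f.
exists f1 => // i /andP[i_gt0 le_ir]; rewrite coef_f1 //.
case: eqVneq => [-> | ne_ir]; first by rewrite mul1r addrC subrK.
by rewrite mul0r addr0 coef_f // i_gt0 -ltnS ltn_neqAle ne_ir.
Qed.

Theorem theorem2p4 (r : nat) (hr : (1 <= r)%N) (n : nat -> int) :
  exists (l : nat) (f : {poly int}),
    [/\ (0 < l)%N,
        divides_Zx f ('X^l - 1) &
        forall i : nat, (1 <= i <= r)%N -> f`_i = n i].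
Proof.
have [f [_ [l l_gt0 dvd_f]] coef_f] := unit_divisor_prescribed n r.
by exists l, f.
Qed.
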